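(* Let $K$ be a compact Hausdorff space and let $\mathcal{A}$ be a set of upper semi-continuous functions $K\to[-\infty,\infty)$. Suppose that there exist a set $\Theta$ of non-negative continuous functions on $K$ such that for each $x\in K$ and each closed subset $S$ of $K$ with $x\notin S$ there is $\vartheta\in\Theta$ with $S(\vartheta)=\{x\}$ and $\vartheta=0$ on $S$, and a positive function $\omega\in\mathcal{A}[\Theta]$ such that $\mathcal{A}+\{\varepsilon\omega\}\subset\mathcal{A}[\Theta]$ for every $\varepsilon>0$. Then $$\check{S}_{\mathcal{A}}=\overline{P}_{\mathcal{A}}\in b_{\mathcal{A}}.$$
   Context: A function $f:K\to[-\infty,\infty)$ is upper semi-continuous if $\{x\in K: f(x)<c\}$ is open for every $c\in\mathbb{R}$; such a function attains its maximum on $K$. Put $S(f):=\{x\in K: f(x)=\max_K f\}$. A subset $S\subset K$ is a boundary for $\mathcal{A}$ if $S\cap S(f)\neq\emptyset$ for every $f\in\mathcal{A}$. $b_{\mathcal{A}}$ is the set of all closed boundaries for $\mathcal{A}$ and $\check{S}_{\mathcal{A}}:=\bigcap_{S\in b_{\mathcal{A}}}S$ is the Shilov boundary for $\mathcal{A}$. A point $x\in K$ is a peak point for $\mathcal{A}$ if there is $f\in\mathcal{A}$ with $S(f)=\{x\}$; $P_{\mathcal{A}}$ is the set of all peak points for $\mathcal{A}$ and $\overline{P}_{\mathcal{A}}$ is its closure. $\mathcal{A}[\Theta]$ denotes the set of all $f\in\mathcal{A}$ such that for every $\vartheta\in\Theta$ there is $\varepsilon_0>0$ with $f+\varepsilon\vartheta\in\mathcal{A}$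 for every $\varepsilon\in(-\varepsilon_0,\varepsilon_0)$. For $g:K\to[-\infty,\infty)$, $\mathcal{A}+\{g\}:=\{f+g: f\in\mathcal{A}\}$. *)

(* Defs.v *)
From mathcomp Require Import all_boot all_order all_algebra.
From mathcomp Require Import all_classical all_reals all_analysis.

Set Implicit Arguments.
Unset Strict Implicit.
Unset Printing Implicit Defensive.

Import Order.TTheory GRing.Theory Num.Theory.
Import numFieldNormedType.Exports.

Local Open Scope classical_set_scope.
Local Open Scope ring_scope.
Local Open Scope ereal_scope.

(* Functions K -> [-oo, +oo) are represented by functions f : K -> \bar R with
   f x < +oo for all x. *)
Definition lt_pinfty (R : realType) (K : Type) (f : K -> \bar R) : Prop :=
  forall x, f x < +oo.

Definition upper_semicontinuous (R : realType) (K : topologicalType)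
    (f : K -> \bar R) : Prop :=
  forall c : R, open [set x | f x < c%:E].

(* S(f); the supremum is max_K f when f attains its maximum, as it does when f
   is upper semicontinuous and K is compact and nonempty. *)
Definition max_set (R : realType) (K : Type) (f : K -> \bar R) : set K :=
  [set x | f x = ereal_sup (range f)].

Definition boundary (R : realType) (K : Type) (A : set (K -> \bar R))
    (S : set K) : Prop :=
  forall f, A f -> S `&` max_set f !=set0.

Definition closed_boundaries (R : realType) (K : topologicalType)
    (A : set (K -> \bar R)) : set (set K) :=
  [set S | closed S /\ boundary A S].

Definition shilov_boundary (R : realType) (K : topologicalType)
    (A : set (K -> \bar R)) : set K :=
  \bigcap_(S in closed_boundaries A) S.

Definition peak_points (R : realType) (K : Type) (A : set (K -> \bar R)) :
    set K :=
  [set x | exists2 f, A f & max_set f = [set x]].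

(* A[Theta] *)
Definition perturbable (R : realType) (K : Type) (A : set (K -> \bar R))
    (Theta : set (K -> R)) : set (K -> \bar R) :=
  [set f | A f /\
    forall theta, Theta theta ->
      exists2 eps0 : R, (0 < eps0)%R &
        forall eps : R, (- eps0 < eps)%R -> (eps < eps0)%R ->
          A (fun x => f x + (eps * theta x)%:E)].

(* A + {g} *)
Definition translate (R : realType) (K : Type) (A : set (K -> \bar R))
    (g : K -> \bar R) : set (K -> \bar R) :=
  [set (fun x => f x + g x) | f in A].

(* Main.v *)
(* For f in A with finite maximum, f + eps omega lies in A[Theta]; if x
   maximizes f + eps omega, adding a small multiple of a theta peaking at x
   produces an element of A peaking exactly at x, so x is a peak point.  If f
   had no maximizer in the closure of the peak points, then, by compactness and
   boundedness of omega, neither would f + eps omega for small eps.  When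
   max f = -oo it suffices that a peak point exists, and any maximizer of omega
   is one. *)
Require Import Defs.
From mathcomp Require Import all_boot all_order all_algebra.
From mathcomp Require Import all_classical all_reals all_analysis.
Set Implicit Arguments.
Unset Strict Implicit.
Unset Printing Implicit Defensive.
Import Order.TTheory GRing.Theory Num.Theory.
Import numFieldNormedType.Exports.
Local Open Scope classical_set_scope.
Local Open Scope ring_scope.
Local Open Scope ereal_scope.

Lemma ereal_between (R : realType) (x y : \bar R) :
  x < y -> exists2 r : R, x < r%:E & r%:E < y.
Proof.
case: x y => [x| |] [y| |] //= xy.
- by exists ((x + y) / 2)%R; rewrite lte_fin ?(midf_lt xy).1 ?(midf_lt xy).2.
- by exists (x + 1)%R; rewrite ?ltry// lte_fin ltrDl.
- by exists (y - 1)%R; rewrite ?ltNyr// lte_fin ltrBlDr ltrDl.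
- by exists 0%R; rewrite ?ltNyr ?ltry.
Qed.

(** The open sets [f < c], with [c] real and below [m], increase with [c] and cover [F], so by
    compactness one of them contains [F]. Taking [m = +oo] yields a real upper bound. *)
Lemma usc_compact_lt (R : realType) (K : topologicalType) (F : set K)
    (f : K -> \bar R) (m : \bar R) :
  compact F -> upper_semicontinuous f -> -oo < m ->
  (forall y, F y -> f y < m) ->
  exists2 c : R, c%:E < m & forall y, F y -> f y < c%:E.
Proof.
move=> /compact_near_coveringP cF uscf moo fm.
pose D : set R := [set c | c%:E < m].
(* The intervals [[c, m)] form a base of the filter of reals tending to [m] from below; [-oo < m]
   makes the family nonempty even when [F] is empty. *)
pose B (c : R) : set R := [set c' | (c <= c')%R /\ c'%:E < m].
have D0 : D !=set0 by have [r _ rm] := ereal_between moo; exists r.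
have fB : Filter (filter_from D B).
  apply: filter_from_filter => // i j Di Dj; exists (Num.max i j).
    by rewrite /D /= EFin_max gt_max Di Dj.
  by move=> k [/=]; rewrite ge_max => /andP[ik jk] km.
have [|c Dc Bc] := cF _ _ (fun c y => f y < c%:E) fB.
  move=> x Fx; have [c fc cm] := ereal_between (fm x Fx).
  exists ([set y | f y < c%:E], B c) => /=.
    by split; [exact: (open_nbhs_nbhs (conj (uscf c) fc)) | exists c].
  by move=> [y d] /= [fy [cd _]]; apply: lt_le_trans fy _; rewrite lee_fin.
by exists c => // y; apply: Bc => //; split.
Qed.

(** If the supremum were not attained, [f] would lie strictly below it everywhere, hence by
    compactness below a real [c] smaller than the supremum. *)
Lemma usc_attains_sup (R : realType) (K : topologicalType) (f : K -> \bar R) :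
  [set: K] !=set0 -> compact [set: K] -> upper_semicontinuous f ->
  max_set f !=set0.
Proof.
move=> [x0 _] cK uscf; apply: contrapT => noM.
have flt y : [set: K] y -> f y < ereal_sup (range f).
  move=> _; rewrite lt_neqAle ereal_sup_ubound ?andbT; last by exists y.
  by apply/eqP => fy; apply: noM; exists y.
have sup_gt : -oo < ereal_sup (range f) by apply: le_lt_trans (flt x0 I); rewrite leNye.
have [c csup fc] := usc_compact_lt cK uscf sup_gt flt.
move: csup; rewrite ltNge => /negP; apply.
by apply: ge_ereal_sup => _ [y _ <-]; exact/ltW/fc.
Qed.

Lemma max_setP (R : realType) (K : Type) (f : K -> \bar R) (x : K) :
  max_set f x <-> forall y, f y <= f x.
Proof.
split=> [fx y|fx]; first by rewrite fx; apply: ereal_sup_ubound; exists y.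
apply/eqP; rewrite eq_le ereal_sup_ubound /=; last by exists x.
by apply: ge_ereal_sup => _ [y _ <-].
Qed.

(** Since [x] maximizes both summands, a maximizer of the sum must also maximize [theta], so it
    equals [x]. Finiteness of [g x] keeps the inequality strict when [g x] is added to both
    sides. *)
Lemma max_set_perturb (R : realType) (K : Type) (g : K -> \bar R)
    (theta : K -> R) (eps : R) (x : K) :
  g x \is a fin_num -> max_set g x ->
  max_set (fun y => (theta y)%:E) = [set x] -> (0 < eps)%R ->
  max_set (fun y => g y + (eps * theta y)%:E) = [set x].
Proof.
move=> gfin /max_setP gx thx eps0.
have /max_setP tx : max_set (fun y => (theta y)%:E) x by rewrite thx.
have le y : g y + (eps * theta y)%:E <= g x + (eps * theta x)%:E.
  by apply: leeD => //; rewrite lee_fin ler_pM2l// -lee_fin.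
apply/seteqP; split => [y /max_setP ymax|_ ->]; last exact/max_setP.
rewrite -thx; apply/max_setP => z; apply: le_trans (tx z) _.
rewrite lee_fin leNgt; apply/negP => tyx.
have := ymax x; rewrite leNgt => /negP; apply.
have step : g y + (eps * theta y)%:E <= g x + (eps * theta y)%:E by exact: leeD.
by apply: le_lt_trans step _; rewrite lteD2lE// lte_fin ltr_pM2l.
Qed.

Lemma perturbable_peak (R : realType) (K : topologicalType)
    (A : set (K -> \bar R)) (Theta : set (K -> R)) (g : K -> \bar R) (x : K) :
  (exists2 theta, Theta theta & max_set (fun y => (theta y)%:E) = [set x]) ->
  perturbable A Theta g -> g x \is a fin_num -> max_set g x ->
  peak_points A x.
Proof.
move=> [theta Tt tx] [_ gT] gfin gx.
have [e e0 Ae] := gT _ Tt; have e20 : (0 < e / 2)%R by rewrite divr_gt0.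
exists (fun y => g y + (e / 2 * theta y)%:E); last exact: max_set_perturb.
by apply: Ae; [rewrite (lt_trans _ e20)// oppr_lt0 | rewrite gtr_pMr// invf_lt1// ltr1n].
Qed.

Theorem theorem3p10 (R : realType) (K : topologicalType)
    (K_neq0 : [set: K] !=set0)
    (K_compact : compact [set: K]) (K_hausdorff : hausdorff_space K)
    (A : set (K -> \bar R))
    (A_lty : forall f, A f -> lt_pinfty f)
    (A_usc : forall f, A f -> upper_semicontinuous f)
    (Theta : set (K -> R))
    (Theta_continuous : forall theta, Theta theta -> continuous theta)
    (Theta_ge0 : forall theta, Theta theta -> forall x, (0 <= theta x)%R)
    (Theta_peak : forall (x : K) (S : set K), closed S -> ~ S x ->
      exists theta, [/\ Theta theta,
        max_set (fun y => (theta y)%:E) = [set x] &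
        forall y, S y -> theta y = 0%R])
    (omega : K -> \bar R)
    (omega_gt0 : forall x, 0 < omega x)
    (omega_perturbable : perturbable A Theta omega)
    (omega_translate : forall eps : R, (0 < eps)%R ->
      translate A (fun x => eps%:E * omega x) `<=` perturbable A Theta) :
  shilov_boundary A = closure (peak_points A) /\
  closed_boundaries A (closure (peak_points A)).
Proof.
have Theta_at x :
    exists2 theta, Theta theta & max_set (fun y => (theta y)%:E) = [set x].
  by have [theta [Tt tx _]] := Theta_peak x set0 closed0 id; exists theta.
have A_max f : A f -> max_set f !=set0.
  by move=> /A_usc; exact: usc_attains_sup.
have A_omega : A omega by case: omega_perturbable.
have P_neq0 : peak_points A !=set0.
  have [x xmax] := A_max _ A_omega; exists x.
  apply: (perturbable_peak (Theta_at x) omega_perturbable _ xmax).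
  by rewrite fin_real// A_lty// (lt_trans _ (omega_gt0 x)).
have PS : peak_points A `<=` shilov_boundary A.
  move=> x [f Af fx] S [_ /(_ f Af)[y [Sy]]].
  by rewrite fx => <-.
have closure_sub : closure (peak_points A) `<=` shilov_boundary A.
  move=> x xP S bS; rewrite (iffLR (closure_id S) bS.1).
  by apply: closure_subset xP => y /PS; exact.
have clP_boundary : closed_boundaries A (closure (peak_points A)).
  split; first exact: closed_closure.
  move=> f Af; apply: contrapT => noM.
  have flt y : closure (peak_points A) y -> f y < ereal_sup (range f).
    move=> Py; rewrite lt_neqAle ereal_sup_ubound ?andbT; last by exists y.
    by apply/eqP => fy; apply: noM; exists y.
  have clP_compact : compact (closure (peak_points A)).
    by apply: subclosed_compact K_compact _ => //; exact: closed_closure.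
  (* At any peak point [p], [f p] is strictly below the supremum; this rules out the case where [f]
     is identically [-oo]. *)
  have sup_gt : -oo < ereal_sup (range f).
    have [p /subset_closure/flt] := P_neq0.
    by apply: le_lt_trans; rewrite leNye.
  have [c csup fc] := usc_compact_lt clP_compact (A_usc _ Af) sup_gt flt.
  have [d cd dsup] := ereal_between csup.
  have [M _ omegaM] := usc_compact_lt K_compact (A_usc _ A_omega) (isT : -oo < +oo)
    (fun y _ => A_lty _ A_omega y).
  have M0 : (0 < M)%R.
    by have [x _] := K_neq0; rewrite -lte_fin (lt_trans (omega_gt0 x))// omegaM.
  (* This value gives [c + eps * M = d]: on the closure of the peak points [f + eps omega] stays
     below [d], while its maximum is at least that of [f], hence above [d]. *)
  pose eps := ((d - c) / M)%R.
  have eps0 : (0 < eps)%R by rewrite divr_gt0// subr_gt0 -lte_fin.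
  pose g x := f x + eps%:E * omega x.
  have gT : perturbable A Theta g by apply: (omega_translate _ eps0); exists f.
  have [x gx] := A_max _ gT.1; have [x0 fx0] := A_max _ Af.
  have dg : d%:E < g x.
    apply: (@lt_le_trans _ _ (g x0)); last by move/max_setP: gx.
    apply: lt_le_trans dsup _; rewrite -fx0 leeDl// mule_ge0//.
      by rewrite lee_fin ltW.
    exact: ltW.
  have Px : peak_points A x.
    apply: (perturbable_peak (Theta_at x) gT _ gx).
    by rewrite fin_real// (A_lty _ gT.1) (lt_trans _ dg)// ltNyr.
  have : g x < d%:E.
    have -> : d = (c + eps * M)%R by rewrite divfK ?gt_eqF// addrC subrK.
    rewrite EFinD EFinM lteD//; first exact/fc/subset_closure.
    by rewrite lte_pmul2l// omegaM.
  by rewrite ltNge (ltW dg).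
(* The remaining inclusion holds because the closure is itself one of the closed boundaries being
   intersected. *)
split => //; apply/seteqP; split => // x; exact.
Qed.
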